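(* Let $k>1$ and let $w,v\in\mathcal F_k=\{0,\dots,k-1\}^*$ be non-empty words. Then $\mu_k(v)$ is a $k$-residue of $\mu_k(w)$ iff there exists some $r\in\mathcal F_k$ such that $w=rv$, in which case $\mu_k(r)=\mu_k(w)\backslash\mu_k(v)$.
   Context: $\mathbb N=\{0,1,2,\dots\}$. $\mathcal N_{k^{(\_)}}$ is the monoid with underlying set $\{(m,n)\in\mathbb N\times\mathbb N:n<k^m\}$, composition $(d,c)\cdot(b,a)=(d+b,k^bc+a)$, and identity $\epsilon=(0,0)$. For a word $w\in\mathcal F_k$, $len(w)$ is its length and $num(w)$ is the number it represents in base $k$ (leading zeros allowed): $num$ of the empty word is $0$, $num(x)=x$ for a letter $x$, $num(wx)=k\cdot num(w)+num(x)$. The map $\mu_k:\mathcal F_k\to\mathcal N_{k^{(\_)}}$ is $\mu_k(w)=(len(w),num(w))$. For $(b,a),(y,x)\in\mathcal N_{k^{(\_)}}$, call $(y,x)$ a $k$-residue of $(b,a)$ when $y\le b$ and $a \bmod k^y=x$. The cancellation $(b,a)\backslash(y,x)$ is defined iff $(y,x)$ is a $k$-residue of $(b,a)$, in which case it equals $\left(b-y,\frac{a-x}{k^y}\right)$ if $b>y$ and $\epsilon$ if $b=y$. *)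

(* Defs.v *)
From HB Require Import structures.
From mathcomp Require Import all_boot.

Set Implicit Arguments.
Unset Strict Implicit.
Unset Printing Implicit Defensive.

Definition Nk (k : nat) : Type := {p : nat * nat | p.2 < k ^ p.1}.
HB.instance Definition _ k := SubChoice.on (Nk k).

Section NkMonoid.
Variable k : nat.
Implicit Types p q : Nk k.

Lemma Nk_mul_subproof p q :
  k ^ (val q).1 * (val p).2 + (val q).2 < k ^ ((val p).1 + (val q).1).
Proof.
case: p q => [[d c] /= hc] [[b a] /= ha].
rewrite addnC expnD; apply: (@leq_trans (k ^ b * c.+1)).
  by rewrite mulnS -addSn leq_add2r.
by rewrite mulnC leq_mul2r hc orbT.
Qed.

Definition Nk_mul p q : Nk k :=
  Sub ((val p).1 + (val q).1, k ^ (val q).1 * (val p).2 + (val q).2)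
      (Nk_mul_subproof p q).

Definition Nk_one : Nk k := Sub (0, 0) (ltnSn 0).

Lemma Nk_mulA : associative Nk_mul.
Proof.
move=> p q r; apply: val_inj => /=.
by rewrite addnA mulnDr addnA mulnA -expnD (addnC (val r).1).
Qed.

Lemma Nk_mul1l : left_id Nk_one Nk_mul.
Proof. by case=> -[b a] h; apply: val_inj; rewrite /= muln0. Qed.

Lemma Nk_mul1r : right_id Nk_one Nk_mul.
Proof.
by case=> -[b a] h; apply: val_inj; rewrite /= expn0 mul1n !addn0.
Qed.

HB.instance Definition _ := isMonoid.Build (Nk k) Nk_mulA Nk_mul1l Nk_mul1r.

End NkMonoid.

Definition word (k : nat) : Type := seq 'I_k.

(* Big-endian: the head of the list is the most significant digit, so that
   num (rcons w x) = k * num w + x. *)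
Definition num (k : nat) (w : word k) : nat :=
  foldl (fun (n : nat) (x : 'I_k) => k * n + x) 0 w.

Lemma num_lt (k : nat) (w : word k) : num w < k ^ size w.
Proof.
elim/last_ind: w => [|w x IHw] //.
rewrite /num foldl_rcons -/(num w) size_rcons expnS.
apply: (@leq_trans (k * (num w).+1)); last by rewrite leq_mul2l IHw orbT.
by rewrite mulnS addnC ltn_add2r.
Qed.

Definition mu (k : nat) (w : word k) : Nk k := Sub (size w, num w) (num_lt w).

Definition kresidue (k : nat) (p q : Nk k) : bool :=
  let: (b, a) := val p in
  let: (y, x) := val q in
  (y <= b) && (a %% k ^ y == x).

(* The cancellation p \ q; None encodes "undefined".  The partial injection
   insub never fails here, see kcancel_defined. *)
Definition kcancel (k : nat) (p q : Nk k) : option (Nk k) :=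
  let: (b, a) := val p in
  let: (y, x) := val q in
  if kresidue p q then
    if y < b then insub (b - y, (a - x) %/ k ^ y) else Some (1%g : Nk k)
  else None.

Lemma kcancel_defined (k : nat) (p q : Nk k) :
  isSome (kcancel p q) = kresidue p q.
Proof.
case: p q => [[b a] /= ha] [[y x] /= hx].
rewrite /kcancel /kresidue /=; case: ifP => // /andP[leyb _].
case: ifP => // _; rewrite insubT //=.
rewrite ltn_divLR ?(leq_ltn_trans _ hx) //.
by rewrite -expnD subnK // (leq_ltn_trans (leq_subr _ _)).
Qed.

(* Main.v *)
(* Writing w = r ++ v gives num w = num r * k ^ len v + num v with
   num v < k ^ len v, so num v and num r are the remainder and the quotient of
   num w by k ^ len v.  Conversely, cutting w at length len v from the right
   yields a suffix with the length and the number of v, and a word is determined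
   by these two data. *)

Require Import Defs.
From mathcomp Require Import all_boot.

Lemma num_rcons (k : nat) (w : word k) (x : 'I_k) :
  num (rcons w x) = k * num w + x.
Proof. by rewrite /num foldl_rcons. Qed.

Lemma num_cat (k : nat) (r v : word k) :
  num (r ++ v) = num r * k ^ size v + num v.
Proof.
elim/last_ind: v => [|v x IHv]; first by rewrite cats0 muln1 addn0.
by rewrite -rcons_cat !num_rcons IHv size_rcons expnS mulnDr addnA mulnCA.
Qed.

(** Leading zeros make [num] alone ambiguous. Once the lengths agree, division by [k] gives the last
    letter as remainder and the number of the remaining prefix as quotient, hence the induction from
    the right. *)
Lemma num_inj (k : nat) (u v : word k) :
  size u = size v -> num u = num v -> u = v.
Proof.
elim/last_ind: u v => [|u x IHu] v.
  by move=> /esym/size0nil ->.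
case/lastP: v => [|v y]; rewrite !size_rcons // => -[eq_size].
rewrite !num_rcons ![k * _]mulnC => eq_num.
have k_gt0 : 0 < k by apply: leq_ltn_trans (ltn_ord x).
have eq_uv : num u = num v.
  by move/(congr1 (divn^~ k)): eq_num; rewrite !divnMDl // !divn_small // !addn0.
have eq_xy : x = y.
  by apply/val_inj/eqP; rewrite /= -(eqn_add2l (num u * k)) eq_num eq_uv.
by rewrite (IHu v) // eq_xy.
Qed.

Lemma kresidue_mu_cat (k : nat) (r v : word k) : kresidue (mu (r ++ v)) (mu v).
Proof.
by rewrite /kresidue /= size_cat leq_addl num_cat modnMDl modn_small ?num_lt /=.
Qed.

Lemma kresidue_mu_suffix (k : nat) (w v : word k) :
  kresidue (mu w) (mu v) -> exists r : word k, w = r ++ v.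
Proof.
rewrite /kresidue /= => /andP[le_size /eqP].
set n := size w - size v; rewrite -[in num w](cat_take_drop n w) num_cat.
have size_suffix : size (drop n w) = size v by rewrite size_drop subKn.
(* With the modulus read as [k ^ size (drop n w)], the remainder of [num w] is the number of that
   suffix. *)
rewrite -size_suffix modnMDl modn_small ?num_lt // => eq_num.
by exists (take n w); rewrite -(num_inj _ _ _ size_suffix eq_num) cat_take_drop.
Qed.

Lemma kcancel_mu_cat (k : nat) (r v : word k) :
  kcancel (mu (r ++ v)) (mu v) = Some (mu r).
Proof.
have := kresidue_mu_cat k r v; rewrite /kcancel /= => ->.
rewrite size_cat -[X in X < _]add0n ltn_add2r.
have pow_gt0 : 0 < k ^ size v by apply: leq_ltn_trans (num_lt v).
(* The test of [kcancel] is now [0 < size r]. An empty [r] falls into the branch returning the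
   identity, which is [mu [::]]; otherwise the argument of [insub] simplifies to the pair underlying
   [mu (x :: r)]. *)
case: r => [|x r]; first by congr Some; apply: val_inj.
by rewrite num_cat !addnK mulnK // (valK (mu (x :: r))).
Qed.

Theorem proposition40 (k : nat) (hk : 1 < k) (w v : word k)
    (hw : w <> [::]) (hv : v <> [::]) :
  (kresidue (mu w) (mu v) <-> exists r : word k, w = r ++ v) /\
  (forall r : word k, w = r ++ v -> kcancel (mu w) (mu v) = Some (mu r)).
Proof.
split; last by move=> r ->; apply: kcancel_mu_cat.
split; first exact: kresidue_mu_suffix.
by case=> r ->; apply: kresidue_mu_cat.
Qed.
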